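(* Let $A,B,C$ be real symmetric $n\times n$ matrices with $B\succ 0$ and $C\succ 0$, and let $0<\alpha<\beta<+\infty$. Then the problem $$\text{(HP)}\qquad \min_{(s,t)\in\mathbb{R}^2}\ f(s,t)=s-\sqrt{t}\quad\text{s.t.}\quad (s,t)\in\Omega=\left\{(x^TAx,\,x^TBx):\ \alpha\le x^TCx\le\beta,\ x\in\mathbb{R}^n\right\}$$ is a convex programming problem; that is, the objective function $f$ is convex and the feasible set $\Omega$ is convex.
   Context: $M\succ0$ means that the symmetric matrix $M$ is positive definite. Since $\alpha>0$ and $B\succ0$, every $(s,t)\in\Omega$ has $t>0$.
   Formalization: The formal theorem assumes n ≠ 2, because the claim fails for n = 2: with A=[[0,1],[1,0]], B=diag(3,1), C=I, α=1, β=3/2, Ω contains (0,1) and (0,3) but not (0,2). Convexity of f is stated on t ≥ 0, where √t is defined. *)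

(* Defs.v *)
From HB Require Import structures.
From mathcomp Require Import all_boot all_order all_algebra.
From mathcomp Require Import boolp classical_sets reals convex.
From mathcomp Require Import interval_inference ring lra.

Set Implicit Arguments.
Unset Strict Implicit.
Unset Printing Implicit Defensive.

Import Order.TTheory GRing.Theory Num.Theory.

Local Open Scope classical_set_scope.
Local Open Scope ring_scope.

(* `R^o * R^o` rather than `R * R`, so that the plane is an R-module, as
   `convex_set` and `convex_function` require. *)
Definition plane (R : realType) : lmodType R := (R^o * R^o)%type.

Definition qform (R : realType) (n : nat) (M : 'M[R]_n) (x : 'cV[R]_n) : R :=
  (x^T *m M *m x) 0 0.

Definition posdef (R : realType) (n : nat) (M : 'M[R]_n) : Prop :=
  M \is symmetricmx /\ forall x : 'cV[R]_n, x != 0 -> 0 < qform M x.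

Definition Omega (R : realType) (n : nat) (A B C : 'M[R]_n) (alpha beta : R) :
    set (plane R) :=
  [set (qform A x, qform B x) | x in
    [set x : 'cV[R]_n | alpha <= qform C x <= beta]].

Definition objective (R : realType) (p : plane R) : R := p.1 - Num.sqrt p.2.

(* `Num.sqrt` is 0 on negative reals, so `objective` only means s - sqrt t on
   this half-plane (and it is not convex on the whole plane). *)
Definition objective_dom (R : realType) : set (plane R) :=
  [set p | 0 <= p.2].

(* Minimise f, a function with domain D, over the feasible set S. *)
Definition convex_program (R : realType) (D : set (plane R))
    (f : plane R -> R) (S : set (plane R)) : Prop :=
  [/\ S `<=` D, convex_function D f & convex_set S].

(* Convexity of Omega fails in dimension 2: here Omega contains (0, 1) and
   (0, 3) but not their midpoint (0, 2). *)
Lemma Omega_dim2_not_convex (R : realType) :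
  exists A B C : 'M[R]_2, exists alpha beta : R,
    [/\ A \is symmetricmx, posdef B, posdef C, 0 < alpha < beta &
        ~ convex_set (Omega A B C alpha beta)].
Proof.
pose A : 'M[R]_2 := \matrix_(i, j) (i != j)%:R.
pose B : 'M[R]_2 := \matrix_(i, j) ((i == j)%:R * (if i == 0 then 3 else 1)).
pose C : 'M[R]_2 := 1%:M.
have symP (M : 'M[R]_2) : M^T = M -> M \is symmetricmx.
  by move=> MT; apply/is_hermitianmxP; rewrite expr0 scale1r map_mx_id.
have qE (M : 'M[R]_2) x : qform M x =
    M 0 0 * x 0 0 ^+ 2 + (M 0 1 + M 1 0) * (x 0 0 * x 1 0) + M 1 1 * x 1 0 ^+ 2.
  rewrite /qform !mxE !big_ord_recl big_ord0 !mxE !big_ord_recl !big_ord0 !mxE.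
  have -> : lift (ord0 : 'I_2) ord0 = 1 by apply/val_inj.
  have -> : (ord0 : 'I_2) = 0 by apply/val_inj.
  by ring.
have qA x : qform A x = 2 * (x 0 0 * x 1 0).
  by rewrite qE !mxE /=; ring.
have qB x : qform B x = 3 * x 0 0 ^+ 2 + x 1 0 ^+ 2.
  by rewrite qE !mxE /=; ring.
have qC x : qform C x = x 0 0 ^+ 2 + x 1 0 ^+ 2.
  by rewrite qE !mxE /=; ring.
have sq_gt0 (x : 'cV[R]_2) : x != 0 -> 0 < x 0 0 ^+ 2 + x 1 0 ^+ 2.
  move=> x0; rewrite lt_neqAle addr_ge0 ?sqr_ge0// andbT eq_sym.
  apply: contra x0; rewrite paddr_eq0 ?sqr_ge0// !sqrf_eq0.
  move=> /andP[/eqP a0 /eqP b0]; apply/eqP/colP => i; rewrite mxE.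
  case: i => -[|[|//]] i; first by rewrite -[RHS]a0; congr (x _ _); apply/val_inj.
  by rewrite -[RHS]b0; congr (x _ _); apply/val_inj.
exists A, B, C, 1, (3 / 2); split.
- by apply: symP; apply/matrixP => i j; rewrite !mxE eq_sym.
- split=> [|x /sq_gt0]; last by rewrite qB; have := sqr_ge0 (x 0 0); lra.
  apply: symP; apply/matrixP => i j; rewrite !mxE eq_sym.
  by case: eqP => [->|_] //; rewrite !mul0r.
- split=> [|x /sq_gt0]; last by rewrite qC.
  by apply: symP; exact: tr_scalar_mx.
- by apply/andP; split; lra.
have half01 : 0 <= (1 / 2 : R) <= 1 by apply/andP; split; lra.
pose h : {i01 R} := @Itv01 _ (1 / 2) (proj1 (andP half01)) (proj2 (andP half01)).
move=> /(_ (0, 1) (0, 3) h) cvx.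
have : ((0, 2) : plane R) \in Omega A B C 1 (3 / 2).
  suff <- : conv h ((0, 1) : convex_lmodType (plane R)) (0, 3) = (0, 2).
    apply: cvx; apply/mem_set.
      exists (\col_i (i != 0)%:R); first by rewrite /= qC !mxE/=; lra.
      by rewrite qA qB !mxE/=; congr pair; lra.
    exists (\col_i (i == 0)%:R); first by rewrite /= qC !mxE/=; lra.
    by rewrite qA qB !mxE/=; congr pair; lra.
  congr pair; rewrite /= /unstable.onem; rewrite /GRing.scale/=; lra.
move=> /set_mem[x /=]; rewrite qC => /andP[x1 x2] []; rewrite qA qB => e1 e2.
have : x 0 0 * x 1 0 = 0 by lra.
by move=> /eqP; rewrite mulf_eq0 => /orP[]/eqP e; move: x1 x2 e2; rewrite e; lra.
Qed.

(* Main.v *)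
(* Convexity of the joint range of (A, B, C) (Brickman, Polyak): the target is a
   positive multiple of the image of z as soon as two suitable forms F and H in
   the span of A, B, C vanish at z. Here F vanishes at the two given vectors x
   and y, while H has opposite signs there, so it suffices to join x to y or -y
   inside the cone F = 0 and apply the intermediate value theorem to H. When
   n >= 3 there is w != 0 that is F-orthogonal to x and y, and such a path exists
   in the span of x, y and w. *)
Require Import Defs.
From mathcomp Require Import all_boot all_order all_algebra.
From mathcomp Require Import boolp classical_sets reals convex.
From mathcomp Require Import interval_inference zify ring lra.

Import Order.TTheory GRing.Theory Num.Theory.

Local Open Scope classical_set_scope.
Local Open Scope ring_scope.

(** * Algebra of bilinear and quadratic forms *)

Definition bform {R : realType} {n : nat} (M : 'M[R]_n) (x y : 'cV[R]_n) : R :=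
  (x^T *m M *m y) 0 0.

Section Forms.
Context {R : realType} {n : nat}.
Implicit Types (M N F H : 'M[R]_n) (x y z w : 'cV[R]_n) (a b c : R).

Lemma bformxx M x : bform M x x = qform M x.
Proof. by []. Qed.

Lemma symmetricmx_tr M : M \is symmetricmx -> M^T = M.
Proof. by move=> /is_hermitianmxP; rewrite expr0 scale1r map_mx_id. Qed.

Lemma bformC M x y : M^T = M -> bform M x y = bform M y x.
Proof.
move=> MT; rewrite /bform -[in LHS](trmxK y) -[in LHS](trmxK x).
by rewrite -{1}MT -!trmx_mul mxE !trmxK mulmxA.
Qed.

Lemma bformDr M x y z : bform M x (y + z) = bform M x y + bform M x z.
Proof. by rewrite /bform mulmxDr mxE. Qed.

Lemma bformZr M a x y : bform M x (a *: y) = a * bform M x y.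
Proof. by rewrite /bform -scalemxAr mxE. Qed.

Lemma bformDl M x y z : bform M (y + z) x = bform M y x + bform M z x.
Proof. by rewrite /bform raddfD/= !mulmxDl mxE. Qed.

Lemma bformZl M a x y : bform M (a *: x) y = a * bform M x y.
Proof. by rewrite /bform linearZ/= -!scalemxAl mxE. Qed.

Lemma qformDM M N x : qform (M + N) x = qform M x + qform N x.
Proof. by rewrite /qform mulmxDr mulmxDl mxE. Qed.

Lemma qformZM a M x : qform (a *: M) x = a * qform M x.
Proof. by rewrite /qform -scalemxAr -scalemxAl mxE. Qed.

Lemma qform0 M : qform M 0 = 0.
Proof. by rewrite /qform mulmx0 mxE. Qed.

Lemma qformZ M a x : qform M (a *: x) = a ^+ 2 * qform M x.
Proof. by rewrite -!bformxx bformZl bformZr expr2 mulrA. Qed.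

Lemma qformD M x y : M^T = M ->
  qform M (x + y) = qform M x + qform M y + 2 * bform M x y.
Proof.
by move=> MT; rewrite -!bformxx !(bformDl, bformDr) (bformC M y x MT); ring.
Qed.

Lemma qform_comb3 M a b c x y w : M^T = M ->
  qform M (a *: x + b *: y + c *: w) =
    a ^+ 2 * qform M x + b ^+ 2 * qform M y + c ^+ 2 * qform M w
    + 2 * (a * b * bform M x y + a * c * bform M x w + b * c * bform M y w).
Proof.
move=> MT; rewrite !qformD// !qformZ !(bformDl, bformZl) !bformZr; ring.
Qed.

Lemma posdef_ge0 M x : posdef M -> 0 <= qform M x.
Proof.
by move=> [_ M0]; have [->|/M0/ltW//] := eqVneq x 0; rewrite qform0.
Qed.

(** * Common zeros of two quadratic forms *)

(** Both conditions on [w] are linear: [U] has two columns, so its rank is below [n] and its left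
    kernel is nonzero. *)
Lemma exists_orthogonal_pair F x y : (2 < n)%N ->
  exists w, [/\ w != 0, bform F x w = 0 & bform F y w = 0].
Proof.
move=> n2; pose U := row_mx (x^T *m F)^T (y^T *m F)^T.
have : kermx U != 0.
  rewrite -mxrank_eq0 mxrank_ker subn_eq0 -ltnNge.
  by apply: leq_ltn_trans n2; rewrite (leq_trans (rank_leq_col _)).
move=> /rowV0Pn[v /sub_kermxP]; rewrite mul_mx_row -[0]row_mx0 => /eq_row_mx.
move=> [vx vy] v0; exists v^T; split; first by rewrite trmx_eq0.
- by rewrite /bform -[_ *m v^T]trmxK trmx_mul trmxK vx !mxE.
- by rewrite /bform -[_ *m v^T]trmxK trmx_mul trmxK vy !mxE.
Qed.

Lemma common_zero_segment F H x y : F^T = F -> H^T = H ->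
  x != 0 -> y != 0 -> qform F x = 0 -> qform F y = 0 -> bform F x y = 0 ->
  qform H x <= 0 <= qform H y ->
  exists z, [/\ z != 0, qform F z = 0 & qform H z = 0].
Proof.
move=> FT HT x0 y0 Fx Fy Fxy /andP[Hx Hy].
pose p : {poly R} := (1 - 'X) ^+ 2 * (qform H x)%:P + 'X ^+ 2 * (qform H y)%:P
  + 2%:P * ((1 - 'X) * 'X) * (bform H x y)%:P.
have pE t : p.[t] = qform H ((1 - t) *: x + t *: y).
  by rewrite qformD// !qformZ bformZl bformZr /p !hornerE/=; ring.
have [|t /andP[t0 t1]] := @poly_ivt R p 0 1 ler01.
  by rewrite !pE subr0 subrr !scale1r !scale0r addr0 add0r Hx.
rewrite /root pE => /eqP zt.
have [z0|z0] := eqVneq ((1 - t) *: x + t *: y) 0; last first.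
  exists ((1 - t) *: x + t *: y); split=> //.
  by rewrite qformD// !qformZ bformZl bformZr Fx Fy Fxy; ring.
(* If the root of [H] falls at the origin, [x] and [y] are proportional, so [H] has the same sign at
   both and already vanishes at [x]. *)
exists x; split=> //.
have t_lt1 : t != 1.
  apply: contra_neq y0 => t1'; move: z0.
  by rewrite t1' subrr scale0r add0r scale1r.
have : (1 - t) ^+ 2 * qform H x = t ^+ 2 * qform H y.
  by rewrite -!qformZ -(addr0_eq z0) -scaleN1r (qformZ H (-1)) sqrrN expr1n mul1r.
move=> e; apply/le_anti/andP; split=> //.
have : 0 < (1 - t) ^+ 2 by rewrite exprn_even_gt0//= subr_eq0 eq_sym.
move=> /(pmulr_rge0 (qform H x)) <-; rewrite e.
by rewrite mulr_ge0// sqr_ge0.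
Qed.

(* With [F = 2 f st + k u^2] in the coordinates [(s, t, u)] along [x, y, w], the
   conic [F = 0] carries the curve [((1-r)^2, r^2, m r (1-r))] from [x] to [y]
   when [f] and [k] have opposite signs. *)
Lemma common_zero_conic F H x y w : F^T = F -> H^T = H ->
  qform F x = 0 -> qform F y = 0 -> bform F x w = 0 -> bform F y w = 0 ->
  bform F x y * qform F w < 0 ->
  qform H x <= 0 <= qform H y ->
  exists z, [/\ z != 0, qform F z = 0 & qform H z = 0].
Proof.
move=> FT HT Fx Fy Fxw Fyw fk_lt0 /andP[Hx Hy].
have : bform F x y * qform F w != 0 by rewrite lt_eqF.
rewrite mulf_eq0 negb_or => /andP[f0 k0].
(* On the curve, [F] is [(r (1 - r))^2 (2 f + m^2 k)]; this [m] cancels it, and is real since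
   [f k < 0]. *)
pose m := Num.sqrt (- 2 * (bform F x y * qform F w)) / qform F w.
have m2 : m ^+ 2 * qform F w = - 2 * bform F x y.
  rewrite exprMn sqr_sqrtr; last by lra.
  by field.
pose v t := (1 - t) ^+ 2 *: x + t ^+ 2 *: y + (m * (t * (1 - t))) *: w.
pose p : {poly R} := (1 - 'X) ^+ 4 * (qform H x)%:P + 'X ^+ 4 * (qform H y)%:P
  + (m%:P * ('X * (1 - 'X))) ^+ 2 * (qform H w)%:P
  + 2%:P * (((1 - 'X) ^+ 2 * 'X ^+ 2) * (bform H x y)%:P
    + (1 - 'X) ^+ 2 * (m%:P * ('X * (1 - 'X))) * (bform H x w)%:P
    + 'X ^+ 2 * (m%:P * ('X * (1 - 'X))) * (bform H y w)%:P).
have pE t : p.[t] = qform H (v t).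
  by rewrite /v qform_comb3// /p !hornerE/=; ring.
have v0 : v 0 = x.
  by rewrite /v subr0 expr1n !expr2 !mul0r mulr0 !scale0r !addr0 scale1r.
have v1 : v 1 = y.
  by rewrite /v subrr expr1n !expr2 !mul0r !mulr0 !scale0r !addr0 add0r scale1r.
have [|t _] := @poly_ivt R p 0 1 ler01; first by rewrite !pE v0 v1 Hx.
rewrite /root pE => /eqP zt; exists (v t); split=> //; last first.
  rewrite /v qform_comb3// Fx Fy Fxw Fyw.
  by rewrite (exprMn _ m) (mulrAC (m ^+ 2)) m2; ring.
(* The curve avoids the origin: pairing with [x] and [y] under [F] isolates [t^2] and [(1 - t)^2],
   which cannot both vanish. *)
apply/eqP => vt0.
have xz : t ^+ 2 * bform F x y = 0.
  have : bform F x (v t) = 0 by rewrite vt0 /bform mulmx0 mxE.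
  by rewrite /v !(bformDr, bformZr) bformxx Fx Fxw !mulr0 add0r addr0.
have yz : (1 - t) ^+ 2 * bform F x y = 0.
  have : bform F y (v t) = 0 by rewrite vt0 /bform mulmx0 mxE.
  by rewrite /v !(bformDr, bformZr) bformxx Fy Fyw (bformC F y x)// !mulr0 !addr0.
move: xz yz => /eqP; rewrite mulf_eq0 (negbTE f0) orbF sqrf_eq0 => /eqP ->.
by rewrite subr0 expr1n mul1r => /eqP; rewrite (negbTE f0).
Qed.

(** Segments settle the degenerate cases: if [F] vanishes at [w], the sign of [H] at [w] decides
    whether [x] or [y] is joined to it. Otherwise the conic applies, up to replacing [y] by [- y] to
    correct a sign. *)
Lemma common_zero F H x y : (2 < n)%N -> F^T = F -> H^T = H ->
  x != 0 -> y != 0 -> qform F x = 0 -> qform F y = 0 ->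
  qform H x <= 0 <= qform H y ->
  exists z, [/\ z != 0, qform F z = 0 & qform H z = 0].
Proof.
move=> n2 FT HT x0 y0 Fx Fy /andP[Hx Hy].
have [w [w0 Fxw Fyw]] := exists_orthogonal_pair F x y n2.
have [Fw|Fw] := eqVneq (qform F w) 0.
  have [Hw|Hw] := leP 0 (qform H w).
    by apply: (common_zero_segment F H x w) => //; rewrite Hx.
  apply: (common_zero_segment F H w y) => //; first by rewrite bformC.
  by rewrite (ltW Hw).
have [Fxy|Fxy] := eqVneq (bform F x y) 0.
  by apply: (common_zero_segment F H x y) => //; rewrite Hx.
have : bform F x y * qform F w != 0 by rewrite mulf_neq0.
rewrite neq_lt => /orP[fk|fk].
  by apply: (common_zero_conic F H x y w) => //; rewrite Hx.
have qN M : qform M (- y) = qform M y.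
  by rewrite -scaleN1r qformZ sqrrN expr1n mul1r.
apply: (common_zero_conic F H x (- y) w) => //; rewrite ?qN ?Hx//.
  by rewrite -scaleN1r bformZl Fyw mulr0.
by rewrite -scaleN1r bformZr mulN1r mulNr oppr_lt0.
Qed.

(** * Convexity of the joint range *)

Lemma joint_range_proportional A B C x y l :
  qform C x > 0 -> qform C y > 0 -> 0 <= l <= 1 ->
  qform A y * qform C x = qform A x * qform C y ->
  qform B y * qform C x = qform B x * qform C y ->
  exists z, [/\ qform A z = l * qform A x + (1 - l) * qform A y,
    qform B z = l * qform B x + (1 - l) * qform B y &
    qform C z = l * qform C x + (1 - l) * qform C y].
Proof.
move=> Cx Cy /andP[l0 l1] ACxy BCxy.
pose mu := l + (1 - l) * (qform C y / qform C x).
have mu0 : 0 <= mu.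
  by rewrite addr_ge0// mulr_ge0 ?subr_ge0// divr_ge0// ltW.
have scale M : qform M y * qform C x = qform M x * qform C y ->
    qform M (Num.sqrt mu *: x) = l * qform M x + (1 - l) * qform M y.
  move=> MCxy; rewrite qformZ sqr_sqrtr// /mu mulrDl; congr (_ + _).
  by rewrite -[qform M y](mulfK (lt0r_neq0 Cx)) MCxy; ring.
by exists (Num.sqrt mu *: x); split; apply: scale => //; rewrite mulrC.
Qed.

(* With [P v = (qform A v, qform B v, qform C v)], [N = P x \times P y] and
   [T = l P x + (1 - l) P y], the vector [P z] is proportional to [T] as soon as
   it is orthogonal to [N] and to [N \times T]; the latter is the pencil [H],
   which takes the values [-(1 - l) |N|^2] at [x] and [l |N|^2] at [y]. *)
Lemma joint_range_convex_ge3 A B C x y l : (2 < n)%N ->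
  A^T = A -> B^T = B -> C^T = C -> (forall v, v != 0 -> 0 < qform C v) ->
  x != 0 -> y != 0 -> 0 <= l <= 1 ->
  exists z, [/\ qform A z = l * qform A x + (1 - l) * qform A y,
    qform B z = l * qform B x + (1 - l) * qform B y &
    qform C z = l * qform C x + (1 - l) * qform C y].
Proof.
move=> n2 AT BT CT C0 x0 y0 l01; have /andP[l0 l1] := l01.
have Cx := C0 x x0; have Cy := C0 y y0.
pose t M := l * qform M x + (1 - l) * qform M y.
have tC : 0 < t C.
  rewrite /t; have [->|lN0] := eqVneq l 0; first by lra.
  rewrite ltr_wpDr ?mulr_ge0 ?subr_ge0 ?mulr_gt0 ?(ltW Cy)//.
  by rewrite lt_def lN0.
pose N1 := qform B x * qform C y - qform C x * qform B y.
pose N2 := qform C x * qform A y - qform A x * qform C y.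
pose N3 := qform A x * qform B y - qform B x * qform A y.
pose NN := N1 ^+ 2 + N2 ^+ 2 + N3 ^+ 2.
have NN0 : 0 <= NN by rewrite !addr_ge0 ?sqr_ge0.
(* [NN] is [|N|^2]; when it is zero, [P x] and [P y] are parallel and rescaling [x] suffices. *)
have [N0|NN_neq0] := eqVneq NN 0.
  have N10 : N1 = 0.
    apply/eqP; rewrite -sqrf_eq0; apply/eqP/le_anti; rewrite sqr_ge0 andbT.
    by move: (sqr_ge0 N2) (sqr_ge0 N3); rewrite /NN in N0; lra.
  have N20 : N2 = 0.
    apply/eqP; rewrite -sqrf_eq0; apply/eqP/le_anti; rewrite sqr_ge0 andbT.
    by move: (sqr_ge0 N1) (sqr_ge0 N3); rewrite /NN in N0; lra.
  by apply: joint_range_proportional => //; move: N10 N20; rewrite /N1 /N2; lra.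
pose F := N1 *: A + N2 *: B + N3 *: C.
pose H := (N2 * t C - N3 * t B) *: A + (N3 * t A - N1 * t C) *: B
  + (N1 * t B - N2 * t A) *: C.
have symD a b c : (a *: A + b *: B + c *: C)^T = a *: A + b *: B + c *: C.
  by rewrite !linearD/= !linearZ/= AT BT CT.
have combE a b c v : qform (a *: A + b *: B + c *: C) v =
    a * qform A v + b * qform B v + c * qform C v.
  by rewrite !qformDM !qformZM.
have [|||z [z0]] := common_zero F H x y n2 (symD _ _ _) (symD _ _ _) x0 y0.
- by rewrite combE /N1 /N2 /N3; ring.
- by rewrite combE /N1 /N2 /N3; ring.
- have -> : qform H x = - ((1 - l) * NN).
    by rewrite combE /NN /t /N1 /N2 /N3; ring.
  have -> : qform H y = l * NN.
    by rewrite combE /NN /t /N1 /N2 /N3; ring.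
  by rewrite oppr_le0 !mulr_ge0// subr_ge0.
rewrite !combE => Fz Hz.
have Cz := C0 z z0.
pose V1 := qform B z * t C - qform C z * t B.
pose V2 := qform C z * t A - qform A z * t C.
have Nt : N1 * t A + N2 * t B + N3 * t C = 0.
  by rewrite /t /N1 /N2 /N3; ring.
(* Both use [|N|^2 V = (N . V) N - N \times (N \times V)] for
   [V = P z \times T], where [N . V] and [N \times V] vanish *)
have V10 : V1 = 0.
  apply: (mulfI NN_neq0); rewrite mulr0.
  transitivity (- N1 * 0 - N2 * (qform C z * 0 - t C * 0)
    + N3 * (qform B z * 0 - t B * 0)); last by ring.
  by rewrite -{1}Hz -{1 3}Nt -{1 2}Fz /NN /V1; ring.
have V20 : V2 = 0.
  apply: (mulfI NN_neq0); rewrite mulr0.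
  transitivity (- N2 * 0 - N3 * (qform A z * 0 - t A * 0)
    + N1 * (qform C z * 0 - t C * 0)); last by ring.
  by rewrite -{1}Hz -{1 3}Nt -{1 2}Fz /NN /V2; ring.
(* This scaling matches the [C] coordinate; [V1 = V2 = 0] puts the other two in the same ratio. *)
pose r := Num.sqrt (t C / qform C z).
have r2 : r ^+ 2 = t C / qform C z by rewrite sqr_sqrtr// divr_ge0// ltW.
exists (r *: z); rewrite !qformZ r2; split.
- apply: (mulIf (lt0r_neq0 Cz)).
  by move: V20; rewrite /V2 -/(t A) mulrAC divfK ?gt_eqF//; lra.
- apply: (mulIf (lt0r_neq0 Cz)).
  by move: V10; rewrite /V1 -/(t B) mulrAC divfK ?gt_eqF//; lra.
- by rewrite divfK ?gt_eqF.
Qed.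

Lemma joint_range_convex A B C x y l : n <> 2%N ->
  A^T = A -> B^T = B -> C^T = C -> (forall v, v != 0 -> 0 < qform C v) ->
  x != 0 -> y != 0 -> 0 <= l <= 1 ->
  exists z, [/\ qform A z = l * qform A x + (1 - l) * qform A y,
    qform B z = l * qform B x + (1 - l) * qform B y &
    qform C z = l * qform C x + (1 - l) * qform C y].
Proof.
move=> n2 AT BT CT C0 x0 y0 l01.
have [n3|] := ltnP 2 n; first exact: joint_range_convex_ge3.
move=> n_le2; have n_le1 : (n <= 1)%N by case: n n2 n_le2 => [|[|[|]]].
(* Dimension 0 has no nonzero [x]; in dimension 1, [y] is a multiple of [x]. *)
have [i0|no_ord] := pickP (@predT 'I_n); last first.
  by case/eqP: x0; apply/colP => i; have := no_ord i.
move=> _; have ord_eq i : i = i0.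
  by apply/val_inj; case: i i0 => i ni [j nj] /=; lia.
have ye : y = (y i0 0 / x i0 0) *: x.
  apply/colP => i; rewrite !mxE (ord_eq i) divfK//.
  apply: contra_neq x0 => xi; apply/colP => k.
  by rewrite (ord_eq k) xi mxE.
apply: joint_range_proportional; rewrite ?C0//.
  by rewrite ye !qformZ; ring.
by rewrite ye !qformZ; ring.
Qed.

End Forms.

(** * Convexity of the objective and of the feasible set *)

(** The squares of the two sides differ by [l (1 - l) (sqrt a - sqrt b)^2]. *)
Lemma sqrt_concave {R : realType} (a b l : R) : 0 <= a -> 0 <= b ->
  0 <= l <= 1 ->
  l * Num.sqrt a + (1 - l) * Num.sqrt b <= Num.sqrt (l * a + (1 - l) * b).
Proof.
move=> a0 b0 /andP[l0 l1].
have l1' : 0 <= 1 - l by rewrite subr_ge0.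
have [sa sb] := (sqrtr_ge0 a, sqrtr_ge0 b).
have le0 : 0 <= l * Num.sqrt a + (1 - l) * Num.sqrt b.
  by rewrite addr_ge0 ?mulr_ge0.
rewrite -[leLHS]ger0_norm// -sqrtr_sqr ler_wsqrtr//.
have -> : l * a + (1 - l) * b =
    (l * Num.sqrt a + (1 - l) * Num.sqrt b) ^+ 2
    + l * (1 - l) * (Num.sqrt a - Num.sqrt b) ^+ 2.
  by rewrite -{1}(sqr_sqrtr a0) -{1}(sqr_sqrtr b0); ring.
by rewrite lerDl mulr_ge0 ?sqr_ge0 ?mulr_ge0.
Qed.

Theorem corollary1 (R : realType) (n : nat) (A B C : 'M[R]_n)
    (alpha beta : R) (n_neq2 : n <> 2%N)
    (symA : A \is symmetricmx) (posB : posdef B) (posC : posdef C)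
    (alpha_gt0 : 0 < alpha) (alpha_lt_beta : alpha < beta) :
  convex_program (@objective_dom R) (@objective R) (Omega A B C alpha beta).
Proof.
have l01 (l : {i01 R}) : 0 <= l%:num <= 1.
  by apply/andP; split; [exact: ge0|exact: le1].
have Omega0 : Omega A B C alpha beta `<=` @objective_dom R.
  by move=> _ [x _ <-]; exact: posdef_ge0.
split=> //.
  move=> t p q /set_mem p0 /set_mem q0.
  have := sqrt_concave p.2 q.2 _ p0 q0 (l01 t).
  (* Unfolds the convex combinations in the plane and in [R]; the linear terms in [p.1] and [q.1]
     then cancel. *)
  change (t%:num * Num.sqrt p.2 + (1 - t%:num) * Num.sqrt q.2 <=
      Num.sqrt (t%:num * p.2 + (1 - t%:num) * q.2) ->
    t%:num * p.1 + (1 - t%:num) * q.1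
      - Num.sqrt (t%:num * p.2 + (1 - t%:num) * q.2) <=
    t%:num * (p.1 - Num.sqrt p.2) + (1 - t%:num) * (q.1 - Num.sqrt q.2)).
  by lra.
move=> _ _ t /set_mem[x xC <-] /set_mem[y yC <-]; apply/mem_set.
have neq0 v : alpha <= qform C v <= beta -> v != 0.
  by apply: contraTneq => ->; rewrite qform0 leNgt alpha_gt0.
have /andP[t0 t1] := l01 t.
have [z [Az Bz Cz]] := joint_range_convex A B C x y _ n_neq2
  (symmetricmx_tr _ symA) (symmetricmx_tr _ (proj1 posB))
  (symmetricmx_tr _ (proj1 posC)) (proj2 posC) (neq0 _ xC) (neq0 _ yC) (l01 t).
(* The value of [C] at [z] is a convex combination of two points of [[alpha, beta]], so [z] is
   feasible. *)
exists z.
  rewrite /= Cz; move: xC yC => /andP[x1 x2] /andP[y1 y2].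
  by apply/andP; split; nra.
by rewrite Az Bz.
Qed.
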